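(* Let $K,L$ be finite simplicial complexes. If $\mathcal F_{\mathscr P}(K)\searrow^{d}\mathcal F_{\mathscr P}(L)$, then $K\searrow\!\!\searrow L$.
   Context: The face poset $\mathcal F_{\mathscr P}(K)$ of a simplicial complex $K$ is the poset of nonempty simplices of $K$ ordered by inclusion. In a finite poset $P$, an element $p$ is dismantlable if $P_{>p}=\{y\in P:y>p\}$ has a least element or $P_{<p}=\{y\in P:y<p\}$ has a greatest element. $P\searrow^{d}Q$ means that $Q$ is a subposet of $P$ (with the induced order) and one can go from $P$ to $Q$ by successively deleting elements, each dismantlable in the poset from which it is deleted. A finite simplicial complex $K$ is a simplicial cone $aL$ if there are a (possibly empty) subcomplex $L$ and a vertex $a$ not in $L$ such that the simplices of $K$ are exactly $\{a\}$, the $\sigma\in L$ and the $\{a\}\cup\sigma$ with $\sigma\in L$. For a vertex $x$ of $K$, $\mathrm{lk}_K(x)=\{\sigma\in K: x\notin\sigma,\ \{x\}\cup\sigma\in K\}$ and $K-x=\{\sigma\in K: x\notin\sigma\}$. The vertex $x$ is dismantlable in $K$ if $\mathrm{lk}_K(x)$ is a simplicial cone; the deletion $K\searrow\!\!\searrow K-x$ of such a vertex is an elementary strong collapse, and $K\searrow\!\!\searrow L$ means that $L$ is obtained from $K$ by a finite (possibly empty) succession of elementary strong collapses. *)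

(* Defs.v *)
From mathcomp Require Import all_boot all_order.

Set Implicit Arguments.
Unset Strict Implicit.
Unset Printing Implicit Defensive.

Import Order.TTheory.
Export Order.DefaultSetSubsetOrder.
Local Open Scope order_scope.

(* A finite poset is a subset [P] of an ambient [finPOrderType], with the
   induced order. *)
Section PosetDismantling.

Context {d : Order.disp_t} {T : finPOrderType d}.
Implicit Types (P S : {set T}) (p : T).

Definition above P p : {set T} := [set y in P | p < y].

Definition below P p : {set T} := [set y in P | y < p].

Definition has_least S : bool := [exists m in S, forall y in S, m <= y].

Definition has_greatest S : bool := [exists m in S, forall y in S, y <= m].

Definition poset_dismantlable P p : bool :=
  (p \in P) && (has_least (above P p) || has_greatest (below P p)).

Definition poset_deletion : rel {set T} :=
  [rel P Q | [exists p, poset_dismantlable P p && (Q == P :\ p)]].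

(* [connect] is the reflexive transitive closure. *)
Definition poset_dismantles : rel {set T} := connect poset_deletion.

End PosetDismantling.

Section StrongCollapse.

Context {V : finType}.
Implicit Types (K L : {set {set V}}) (s t : {set V}) (a x : V).

(* A complex is the set of its simplices, which are nonempty. The points of [V]
   need not all be vertices: [x] is a vertex of [K] when [[set x] \in K]. The
   complex without simplices is allowed. *)
Definition simplicial_complex K : bool :=
  (set0 \notin K) &&
  [forall s in K, forall t : {set V}, (t \subset s) && (t != set0) ==> (t \in K)].

(* The order on [{set V}] given by [DefaultSetSubsetOrder] is inclusion. *)
Definition face_poset K : {set {set V}} := K.

Definition cone a L : {set {set V}} :=
  [set a] |: (L :|: [set a |: s | s in L]).

Definition simplicial_cone K : bool :=
  [exists L, exists a,
     [&& simplicial_complex L, [set a] \notin L & K == cone a L]].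

Definition link K x : {set {set V}} :=
  [set s in K | (x \notin s) && (x |: s \in K)].

Definition vertex_deletion K x : {set {set V}} := [set s in K | x \notin s].

Definition vertex_dismantlable K x : bool :=
  ([set x] \in K) && simplicial_cone (link K x).

Definition elementary_strong_collapse : rel {set {set V}} :=
  [rel K L | [exists x, vertex_dismantlable K x && (L == vertex_deletion K x)]].

Definition strong_collapse : rel {set {set V}} :=
  connect elementary_strong_collapse.

End StrongCollapse.

(* Main.v *)
Require Import Defs.
From mathcomp Require Import all_boot all_order.

(** A dismantling of face posets is a homotopy seen by vertex maps.  Deleting a
    dismantlable element from a poset is the same as retracting the poset by a
    monotone map that is pointwise comparable to the identity
    ([poset_dismantlable_retraction]).  Composing these retractions along the
    given dismantling yields monotone maps [f] from the faces of [K] to faces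
    of [K], each comparable to the next, from the identity to a retraction onto
    the faces of [L].

    Choosing a vertex of [f {v}] for every vertex [v] turns such an [f] into a
    simplicial map: all vertices of [s] go into [f s] by monotonicity.
    Comparable [f] and [g] give contiguous simplicial maps, since the images of
    [s] lie in the larger of [f s] and [g s].  Hence the identity of [K] is
    joined, through contiguous maps fixing the vertices of [L], to a simplicial
    map from [K] to [L] ([dismantling_contiguity_class]).

    Such a chain of maps forces strong collapses.  The first map [psi] in it
    which moves a vertex [v] is contiguous to the identity, so every simplex
    containing [v] can be enlarged by [psi v]: [v] is dominated by [psi v], its
    link is a cone, and [v] is not in [L].  Composing the whole chain with the
    retraction [v |-> psi v] gives a chain of the same kind on [K - v], and the
    argument is repeated ([contiguity_class_strong_collapse]).  When no vertex
    is moved, the last map is the identity on [K] with values in [L], and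
    [K = L]. *)

Set Implicit Arguments.
Unset Strict Implicit.
Unset Printing Implicit Defensive.

Import Order.TTheory.

(** * Retractions given by dismantlable elements *)

Section PosetRetraction.

Context {d : Order.disp_t} {T : finPOrderType d}.
Implicit Types (P Q : {set T}) (p : T).
Local Open Scope order_scope.

(** The retraction moves only [p], to the least element above it or to the
    greatest element below it; being extremal makes it monotone. *)
Lemma poset_dismantlable_retraction P p : poset_dismantlable P p ->
  exists r : T -> T,
    [/\ {in P, forall x, r x \in P :\ p}, {in P &, {homo r : x y / x <= y}},
        forall x, x != p -> r x = x
      & (forall x, x <= r x) \/ (forall x, r x <= x)].
Proof.
case/andP=> pP /orP[] /exists_inP[q]; rewrite inE => /andP[qP ltpq] /forall_inP qE;
  exists (fun x => if x == p then q else x).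
- split=> [x xP|x y xP yP lexy|x /negPf-> //|].
  + case: (eqVneq x p) => [_|xp]; rewrite !inE ?xp // qP andbT.
    by rewrite (gt_eqF ltpq).
  + case: (eqVneq x p) lexy => [->|xp]; case: (eqVneq y p) => [->|yp] lexy //.
      by apply: qE; rewrite inE yP lt_def yp.
    exact: le_trans lexy (ltW ltpq).
  + by left=> x; case: eqVneq => [->|//]; exact: ltW.
- split=> [x xP|x y xP yP lexy|x /negPf-> //|].
  + case: (eqVneq x p) => [_|xp]; rewrite !inE ?xp // qP andbT.
    by rewrite (lt_eqF ltpq).
  + case: (eqVneq x p) lexy => [->|xp]; case: (eqVneq y p) => [->|yp] lexy //.
      exact: le_trans (ltW ltpq) lexy.
    by apply: qE; rewrite inE xP lt_neqAle xp.
  + by right=> x; case: eqVneq => [->|//]; exact: ltW.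
Qed.

Lemma path_poset_deletion_subset P (Qs : seq {set T}) :
  path poset_deletion P Qs -> last P Qs \subset P.
Proof.
elim: Qs P => [|Q Qs IH] P //= /andP[/existsP[p /andP[_ /eqP QE]] /IH].
by move/subset_trans; apply; rewrite QE subD1set.
Qed.

End PosetRetraction.

Section Contiguity.

Context {V : finType}.
Implicit Types (K L : {set {set V}}) (s t : {set V}) (a v : V).
Implicit Types (f g : {set V} -> {set V}) (phi psi : {ffun V -> V}).

(** * Simplicial complexes and dominated vertices *)

Lemma simplex_neq0 K s : simplicial_complex K -> s \in K -> s != set0.
Proof. by case/andP=> K0 _ sK; apply: contraNneq K0 => <-. Qed.

Lemma simplex_subset K s t : simplicial_complex K ->
  s \in K -> t \subset s -> t != set0 -> t \in K.
Proof.
case/andP=> _ /forall_inP/(_ s) h /h /forallP/(_ t) /implyP{}h ts t0.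
by apply: h; rewrite ts.
Qed.

Lemma simplex_vertex K s v : simplicial_complex K ->
  s \in K -> v \in s -> [set v] \in K.
Proof.
move=> hK sK vs; apply: (simplex_subset hK sK); first by rewrite sub1set.
by apply/set0Pn; exists v; rewrite inE.
Qed.

Lemma simplex_imset K s phi : simplicial_complex K -> s \in K ->
  phi @: s != set0.
Proof.
move=> hK /(simplex_neq0 hK) /set0Pn[v vs].
by apply/set0Pn; exists (phi v); exact: imset_f.
Qed.

Definition dominated K v a : Prop :=
  [/\ [set v] \in K, a != v & forall s, s \in K -> v \in s -> a |: s \in K].

(** The apex of the link is [a], its base the simplices of the link that avoid
    [a]. *)
Lemma dominated_dismantlable K v a : simplicial_complex K ->
  dominated K v a -> vertex_dismantlable K v.
Proof.
move=> hK [vK av adom]; rewrite /vertex_dismantlable vK /=.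
have aK : [set a] \in K.
  by apply: (simplex_vertex hK (adom _ vK _)); rewrite !inE eqxx.
have link_down s t : s \in link K v -> t \subset s -> t != set0 ->
    t \in link K v.
  rewrite !inE => /and3P[sK vs vsK] ts t0; apply/and3P; split.
  - exact: (simplex_subset hK sK).
  - by apply: contra vs; exact: (subsetP ts).
  - apply: (simplex_subset hK vsK); first exact: setUS.
    by apply/set0Pn; exists v; rewrite setU11.
apply/existsP; exists [set s in link K v | a \notin s].
apply/existsP; exists a; apply/and3P; split; last (apply/eqP/setP=> s).
- apply/andP; split.
    by apply/negP; rewrite !inE => /andP[/andP[/(simplex_neq0 hK)/eqP]].
  apply/forall_inP=> s; rewrite inE => /andP[sK sa].
  apply/forallP=> t; apply/implyP=> /andP[ts t0].
  rewrite inE (link_down s t) //=.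
  by apply: contra sa; exact: (subsetP ts).
- by rewrite !inE eqxx !andbF.
- have [as_|as_] := boolP (a \in s); last first.
    rewrite /cone 2!in_setU in_set1 [in RHS]inE as_ andbT.
    have /negPf-> : s != [set a] by apply: contraNneq as_ => ->; rewrite inE.
    rewrite /= orbC; case: imsetP => // -[t _ E].
    by rewrite E setU11 in as_.
  rewrite /cone 2!in_setU in_set1 [in RHS]inE as_ andbF /=.
  apply/idP/orP => [sK|].
  + case: (eqVneq s [set a]) => [|sa]; [by left | right].
    apply/imsetP; exists (s :\ a); last by rewrite setD1K.
    rewrite inE setD11 andbT; apply: link_down sK (subD1set _ _) _.
    by apply: contraNneq sa => E; rewrite -(setD1K as_) E setU0.
  + case=> [/eqP->|/imsetP[t]].
      rewrite inE aK in_set1 eq_sym av /= setUC; apply: adom vK _.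
      by rewrite in_set1.
    rewrite 2!inE => /andP[/and3P[tK vt vtK] at_ ->].
    have avtK := adom _ vtK (setU11 _ _).
    rewrite inE setUCA avtK in_setU1 negb_or eq_sym av vt !andbT.
    apply: (simplex_subset hK avtK); first by rewrite setUS // subsetUr.
    by apply/set0Pn; exists a; rewrite setU11.
Qed.

Lemma vertex_deletion_complex K v :
  simplicial_complex K -> simplicial_complex (vertex_deletion K v).
Proof.
move=> hK; apply/andP; split; first by rewrite inE; case/andP: hK => /negPf->.
apply/forall_inP=> s; rewrite inE => /andP[sK vs].
apply/forallP=> t; apply/implyP=> /andP[ts t0].
rewrite inE (simplex_subset hK sK ts t0) /=.
by apply: contra vs; exact: (subsetP ts).
Qed.

(** * Contiguous vertex maps *)

Definition fixes_vertices K phi : Prop :=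
  forall v, [set v] \in K -> phi v = v.

(** Contiguity relative to [L]; the first clause concerns the target only, as
    the chains considered start at a map that fixes [L]. *)
Definition contiguous K L : rel {ffun V -> V} :=
  [rel phi psi : {ffun V -> V}
    | [forall v, ([set v] \in L) ==> (psi v == v)] &&
      [forall s in K, phi @: s :|: psi @: s \in K]].

Lemma contiguousP K L phi psi :
  reflect (fixes_vertices L psi /\
           (forall s, s \in K -> phi @: s :|: psi @: s \in K))
          (contiguous K L phi psi).
Proof.
apply: (iffP andP) => -[h1 h2]; split.
- by move=> v vL; apply/eqP; exact: (implyP (forallP h1 v)).
- by move=> s sK; exact: (forall_inP h2).
- by apply/forallP=> v; apply/implyP=> /h1->.
- exact/forall_inP.
Qed.

Lemma fixes_vertices_imset K phi s : simplicial_complex K ->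
  fixes_vertices K phi -> s \in K -> phi @: s = s.
Proof.
move=> hK phiE sK; rewrite -[RHS]imset_id; apply: eq_in_imset => v vs.
by apply: phiE; exact: simplex_vertex vs.
Qed.

(** The first map of the chain that moves a vertex [v] of [K] is contiguous to
    a map fixing all of them, so its image of [v] dominates [v]; and [v] is not
    in [L] because the chain is relative to [L]. *)
Lemma contiguity_class_dominated K L phi0 phi : simplicial_complex K ->
  fixes_vertices K phi0 -> connect (contiguous K L) phi0 phi ->
  fixes_vertices K phi \/
  exists v a, dominated K v a /\ [set v] \notin L.
Proof.
move=> hK id0 /connectP[psis path_psis ->].
elim: psis phi0 id0 path_psis => [|psi psis IH] phi0 id0 /=; first by left.
case/andP=> /contiguousP[fixL psiK].
have [/existsP[v /andP[vK psiv]] _|] :=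
    boolP [exists v, ([set v] \in K) && (psi v != v)].
- right; exists v, (psi v); split; last first.
    by apply: contraNN psiv => /fixL->.
  split=> // s sK vs; have sK' := psiK s sK.
  rewrite (fixes_vertices_imset hK id0 sK) in sK'.
  apply: (simplex_subset hK sK').
    by rewrite setUC setUS // sub1set imset_f.
  by apply/set0Pn; exists (psi v); rewrite setU11.
- move=> /existsPn psi_id; apply: IH => v vK.
  by apply/eqP; move: (psi_id v); rewrite vK negbK.
Qed.

Definition move_vertex v a : {ffun V -> V} :=
  [ffun w => if w == v then a else w].

Definition compose phi psi : {ffun V -> V} := [ffun w => phi (psi w)].

Lemma compose_imset phi psi s : compose phi psi @: s = phi @: (psi @: s).
Proof. by rewrite -imset_comp; apply: eq_imset => w; rewrite ffunE. Qed.

Lemma move_vertex_imset_id v a s : v \notin s -> move_vertex v a @: s = s.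
Proof.
move=> vs; rewrite -[RHS]imset_id; apply: eq_in_imset => w ws.
by rewrite ffunE; case: eqP ws vs => // -> ->.
Qed.

(** Domination is what makes the map [v |-> a] simplicial. *)
Lemma move_vertex_simplex K v a s : simplicial_complex K ->
  dominated K v a -> s \in K -> move_vertex v a @: s \in vertex_deletion K v.
Proof.
move=> hK [_ av adom] sK; rewrite inE.
have -> : v \notin move_vertex v a @: s.
  apply/imsetP=> -[w ws]; rewrite ffunE; case: eqVneq => [_ va|wv vw].
    by rewrite va eqxx in av.
  by rewrite vw eqxx in wv.
rewrite andbT; have [vs|/move_vertex_imset_id-> //] := boolP (v \in s).
apply: (simplex_subset hK (adom s sK vs)); last exact: (simplex_imset _ hK).
apply/subsetP=> _ /imsetP[w ws ->]; rewrite ffunE in_setU1.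
by case: ifP; rewrite ?eqxx // ws orbT.
Qed.

Lemma contiguous_vertex_deletion K L v a phi psi : simplicial_complex K ->
  dominated K v a -> [set v] \notin L -> contiguous K L phi psi ->
  contiguous (vertex_deletion K v) L
    (compose (move_vertex v a) phi) (compose (move_vertex v a) psi).
Proof.
move=> hK vdom vL /contiguousP[fixL psiK]; apply/contiguousP; split.
  move=> w wL; rewrite !ffunE fixL //.
  by case: eqVneq wL vL => [->->|].
move=> s; rewrite inE => /andP[sK _]; rewrite !compose_imset -imsetU.
exact: move_vertex_simplex (psiK s sK).
Qed.

(** Induction on the number of simplices.  The initial map is only required to
    fix the vertices of [K]: after the deletion of [v], the composite of the
    identity with the retraction still moves [v], which is no longer a
    vertex. *)
Lemma contiguity_class_strong_collapse K L phi0 phi :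
    simplicial_complex K -> simplicial_complex L -> L \subset K ->
    fixes_vertices K phi0 -> connect (contiguous K L) phi0 phi ->
    (forall s, s \in K -> phi @: s \in L) ->
  strong_collapse K L.
Proof.
have [n] := ubnP #|K|; elim: n K phi0 phi => // n IH K phi0 phi cardK.
move=> hK hL LK id0 chain phiL.
case: (contiguity_class_dominated hK id0 chain) => [id_phi|[v [a [vdom vL]]]].
  suff -> : K = L by exact: connect0.
  apply/eqP; rewrite eqEsubset LK andbT; apply/subsetP=> s sK.
  by rewrite -(fixes_vertices_imset hK id_phi sK) phiL.
have vNL s : s \in L -> v \notin s.
  by move=> sL; apply: contra vL; exact: simplex_vertex.
have vK : [set v] \in K by case: vdom.
apply: (connect_trans (y := vertex_deletion K v)).
  apply: connect1; apply/existsP; exists v.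
  by rewrite (dominated_dismantlable hK vdom) eqxx.
apply: (IH _ (compose (move_vertex v a) phi0) (compose (move_vertex v a) phi)).
- apply: leq_trans (_ : #|K| <= n)%N => //; apply: proper_card.
  apply/properP; split; first by apply/subsetP=> s; rewrite inE => /andP[].
  by exists [set v] => //; rewrite inE in_set1 eqxx andbF.
- exact: vertex_deletion_complex.
- by [].
- by apply/subsetP=> s sL; rewrite inE (subsetP LK) //= vNL.
- move=> w; rewrite inE in_set1 eq_sym => /andP[wK /negPf wv].
  by rewrite !ffunE id0 // wv.
- case/connectP: chain => psis path_psis ->.
  elim: psis phi0 path_psis {id0} => [|psi psis IHp] phi0 /=.
    by move=> _; exact: connect0.
  case/andP=> step /IHp; apply: connect_trans; apply: connect1.
  exact: contiguous_vertex_deletion.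
- move=> s; rewrite inE compose_imset => /andP[sK _].
  by rewrite move_vertex_imset_id ?phiL // vNL // phiL.
Qed.

(** * Vertex maps carried by monotone maps of faces *)

Definition vertex_choice f : {ffun V -> V} :=
  [ffun v => odflt v [pick w in f [set v]]].

Lemma vertex_choice_fixes f v : f [set v] = [set v] -> vertex_choice f v = v.
Proof.
by rewrite ffunE => ->; case: pickP => [w|//]; rewrite inE => /eqP.
Qed.

(** [vertex_choice f v] lies in [f [set v]], which [f s] contains when [v] is
    in [s].  The simplicial map is thus carried by [f], which reduces contiguity
    to comparability of monotone maps. *)
Lemma vertex_choice_imset_subset K f s : simplicial_complex K ->
  {in K, forall t, f t \in K} ->
  {in K &, {homo f : t u / t \subset u}} ->
  s \in K -> vertex_choice f @: s \subset f s.
Proof.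
move=> hK fK f_homo sK; apply/subsetP=> _ /imsetP[v vs ->].
have vK := simplex_vertex hK sK vs; rewrite ffunE.
case: pickP => [w|/= f0].
  by apply/subsetP; apply: f_homo; rewrite ?sub1set.
have /set0Pn[w] := simplex_neq0 hK (fK _ vK).
by rewrite f0.
Qed.

(** A dismantling starting from any intermediate poset [P] onto which [K] has
    been retracted by [f]; each deletion composes [f] with one more
    retraction. *)
Lemma path_contiguity_class K L (P : {set {set V}})
    (Qs : seq {set {set V}}) f :
    simplicial_complex K -> simplicial_complex L -> P \subset K ->
    path poset_deletion P Qs -> last P Qs = L ->
    {in K, forall s, f s \in P} -> {in K &, {homo f : s t / s \subset t}} ->
    {in L, forall s, f s = s} ->
  exists2 phi, connect (contiguous K L) (vertex_choice f) phi
             & forall s, s \in K -> phi @: s \in L.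
Proof.
move=> hK hL; elim: Qs P f => [|Q Qs IH] P f PK /=.
  move=> _ PL fP f_homo _; exists (vertex_choice f); first exact: connect0.
  move=> s sK; rewrite -PL in hL *.
  apply: (simplex_subset hL (fP s sK)); last exact: (simplex_imset _ hK).
  by apply: vertex_choice_imset_subset sK => // t /fP; apply: (subsetP PK).
case/andP=> /existsP[p /andP[pdism /eqP QE]] pathQ lastQ fP f_homo f_id.
have LQ : L \subset Q by rewrite -lastQ; exact: path_poset_deletion_subset.
have QK : Q \subset K by apply: subset_trans PK; rewrite QE subD1set.
have [r [rP r_homo r_id r_cmp]] := poset_dismantlable_retraction pdism.
have gP : {in K, forall s, r (f s) \in Q}.
  by move=> s /fP /rP; rewrite QE.
have g_homo : {in K &, {homo (r \o f) : s t / s \subset t}}.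
  move=> s t sK tK st; apply: r_homo; [exact: fP | exact: fP |].
  exact: f_homo st.
have g_id : {in L, forall s, r (f s) = s}.
  move=> s sL; rewrite f_id // r_id //.
  by move: (subsetP LQ s sL); rewrite QE !inE => /andP[].
have [phi chain phiL] := IH Q (r \o f) QK pathQ lastQ gP g_homo g_id.
exists phi => //; apply: connect_trans chain; apply: connect1.
apply/contiguousP; split.
  by move=> v vL; apply: vertex_choice_fixes; exact: g_id.
move=> s sK.
have fK : {in K, forall t, f t \in K} by move=> t /fP; apply: (subsetP PK).
have gK : {in K, forall t, r (f t) \in K} by move=> t /gP; apply: (subsetP QK).
have f_sub := vertex_choice_imset_subset hK fK f_homo sK.
have g_sub := vertex_choice_imset_subset hK gK g_homo sK.
have nz : vertex_choice f @: s :|: vertex_choice (r \o f) @: s != set0.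
  by rewrite setU_eq0 negb_and (simplex_imset _ hK sK).
case: r_cmp => /(_ (f s)) le_fr.
- apply: (simplex_subset hK (gK s sK)) => //.
  by rewrite subUset g_sub andbT (subset_trans f_sub le_fr).
- apply: (simplex_subset hK (fK s sK)) => //.
  by rewrite subUset f_sub (subset_trans g_sub le_fr).
Qed.

Lemma dismantling_contiguity_class K L :
    simplicial_complex K -> simplicial_complex L ->
    poset_dismantles (face_poset K) (face_poset L) ->
  exists phi0 phi, [/\ L \subset K, fixes_vertices K phi0,
    connect (contiguous K L) phi0 phi & forall s, s \in K -> phi @: s \in L].
Proof.
move=> hK hL /connectP[Qs pathQ lastQ].
have [phi chain phiL] := path_contiguity_class (f := id) hK hL (subxx K) pathQ
  (esym lastQ) (fun _ sK => sK) (fun _ _ _ _ st => st) (fun _ _ => erefl).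
exists (vertex_choice id), phi; split => //.
- by rewrite [L]lastQ; exact: path_poset_deletion_subset.
- by move=> v _; exact: vertex_choice_fixes.
Qed.

End Contiguity.

Theorem theorem5p2 (V : finType) (K L : {set {set V}})
    (hK : simplicial_complex K) (hL : simplicial_complex L) :
  poset_dismantles (face_poset K) (face_poset L) -> strong_collapse K L.
Proof.
case/(dismantling_contiguity_class hK hL)=> phi0 [phi [LK id0 chain phiL]].
exact: contiguity_class_strong_collapse LK id0 chain phiL.
Qed.
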